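(* The variety $\mathsf{ELHSLat}$ of equationally linear Heyting semilattices is not locally algebraically cartesian closed.
   Context: A Heyting semilattice $(H,1,\wedge,\to)$ is a meet-semilattice with top element $1$ and a binary operation $\to$ such that $x\wedge y\leq z$ if and only if $x\leq y\to z$. Morphisms preserve $1$, $\wedge$ and $\to$. It is equationally linear when it satisfies $((x\to y)\to z)\wedge((y\to x)\to z)=z$. $\mathsf{ELHSLat}$ is the variety (category) of equationally linear Heyting semilattices and their morphisms. For an object $B$ of a category $\mathcal{C}$ with finite limits, $\mathsf{Pt}_B(\mathcal{C})$ is the category of points over $B$: objects are triples $(A,\alpha\colon A\to B,\beta\colon B\to A)$ with $\alpha\beta=1_B$; morphisms are morphisms between the objects $A$ commuting with the given split epimorphisms and sections. For $p\colon E\to B$, the change-of-base functor $p^*\colon\mathsf{Pt}_B(\mathcal{C})\to\mathsf{Pt}_E(\mathcal{C})$ sends $(A,\alpha,\beta)$ to the pullback of $\alpha$ along $p$ with the induced section. A finitely complete category $\mathcal{C}$ is locally algebraically cartesian closed when, for every morphism $p\colon E\to B$ in $\mathcal{C}$, the functor $p^*$ admits a right adjoint. *)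

(* Defs.v *)
From mathcomp Require Import all_boot.
From mathcomp Require Import boolp.

Set Implicit Arguments.
Unset Strict Implicit.
Unset Printing Implicit Defensive.
#[local] Obligation Tactic := idtac.

Declare Scope cat_scope.
Delimit Scope cat_scope with cat.
Local Open Scope cat_scope.

Record category := Category {
  obj :> Type;
  hom : obj -> obj -> Type;
  idm : forall x, hom x x;
  comp : forall x y z, hom y z -> hom x y -> hom x z;
  comp1m : forall x y (f : hom x y), comp (idm y) f = f;
  compm1 : forall x y (f : hom x y), comp f (idm x) = f;
  compA : forall x y z t (h : hom z t) (g : hom y z) (f : hom x y),
    comp h (comp g f) = comp (comp h g) f
}.
Arguments hom {c} x y.
Arguments idm {c} x.
Arguments comp {c x y z} g f.

Notation "x ~> y" := (hom x y) (at level 99, y at level 200) : cat_scope.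
Notation "g \c f" := (comp g f) (at level 50, left associativity) : cat_scope.

Record functor (C D : category) := Functor {
  fobj :> C -> D;
  fmap : forall x y, (x ~> y) -> (fobj x ~> fobj y);
  fmap1 : forall x, fmap (idm x) = idm (fobj x);
  fmapM : forall x y z (g : y ~> z) (f : x ~> y),
    fmap (g \c f) = fmap g \c fmap f
}.
Arguments fmap {C D} f {x y} _ : rename.

Record adjunction (C D : category) (F : functor C D) (G : functor D C) :=
  Adjunction {
  transpose : forall (x : C) (y : D), (F x ~> y) -> (x ~> G y);
  transpose_bij : forall x y, bijective (@transpose x y);
  transpose_natl : forall (x x' : C) (y : D) (f : x' ~> x) (h : F x ~> y),
    transpose (h \c fmap F f) = transpose h \c f;
  transpose_natr : forall (x : C) (y y' : D) (g : y ~> y') (h : F x ~> y),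
    transpose (g \c h) = fmap G g \c transpose h
}.

Definition has_right_adjoint (C D : category) (F : functor C D) : Prop :=
  exists G : functor D C, inhabited (adjunction F G).

Record terminal (C : category) := Terminal {
  term_obj :> C;
  term_arr : forall x : C, x ~> term_obj;
  term_uniq : forall (x : C) (f : x ~> term_obj), f = term_arr x
}.

Record pullback (C : category) (X Y B : C) (p : X ~> B) (q : Y ~> B) :=
  Pullback {
  pb_obj :> C;
  pb_fst : pb_obj ~> X;
  pb_snd : pb_obj ~> Y;
  pb_comm : p \c pb_fst = q \c pb_snd;
  pb_lift : forall (Z : C) (f : Z ~> X) (g : Z ~> Y),
    p \c f = q \c g -> Z ~> pb_obj;
  pb_lift_fst : forall Z f g (e : p \c f = q \c g),
    pb_fst \c @pb_lift Z f g e = f;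
  pb_lift_snd : forall Z f g (e : p \c f = q \c g),
    pb_snd \c @pb_lift Z f g e = g;
  pb_uniq : forall (Z : C) (h k : Z ~> pb_obj),
    pb_fst \c h = pb_fst \c k -> pb_snd \c h = pb_snd \c k -> h = k
}.
Arguments pb_fst {C X Y B p q} _.
Arguments pb_snd {C X Y B p q} _.
Arguments pb_lift {C X Y B p q} _ {Z f g} _.

(* Finite limits are given by a chosen terminal object and chosen pullbacks;
   the choice makes the change-of-base functor a definite functor. *)
Record finlimCategory := FinlimCategory {
  fc_cat :> category;
  fc_terminal : terminal fc_cat;
  fc_pullback : forall (X Y B : fc_cat) (p : X ~> B) (q : Y ~> B),
    pullback p q
}.

Section Points.
Variables (C : category) (B : C).

Record point := Point {
  pt_obj :> C;
  pt_epi : pt_obj ~> B;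
  pt_sec : B ~> pt_obj;
  pt_secK : pt_epi \c pt_sec = idm B
}.

Record point_hom (P Q : point) := PointHom {
  pt_mor :> pt_obj P ~> pt_obj Q;
  pt_mor_epi : pt_epi Q \c pt_mor = pt_epi P;
  pt_mor_sec : pt_mor \c pt_sec P = pt_sec Q
}.

Lemma point_hom_eq (P Q : point) (f g : point_hom P Q) :
  pt_mor f = pt_mor g -> f = g.
Proof.
case: f g => [f f1 f2] [g g1 g2] /= e; case: _ / e g1 g2 => g1 g2.
by congr PointHom; apply: Prop_irrelevance.
Qed.

Program Definition point_id (P : point) : point_hom P P :=
  @PointHom P P (idm _) _ _.
Next Obligation. by move=> P; rewrite compm1. Qed.
Next Obligation. by move=> P; rewrite comp1m. Qed.

Program Definition point_comp (P Q S : point)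
    (g : point_hom Q S) (f : point_hom P Q) : point_hom P S :=
  @PointHom P S (pt_mor g \c pt_mor f) _ _.
Next Obligation. by move=> P Q S g f; rewrite compA !pt_mor_epi. Qed.
Next Obligation. by move=> P Q S g f; rewrite -compA !pt_mor_sec. Qed.

Program Definition Pt : category :=
  @Category point point_hom point_id point_comp _ _ _.
Next Obligation. by move=> P Q f; apply/point_hom_eq/comp1m. Qed.
Next Obligation. by move=> P Q f; apply/point_hom_eq/compm1. Qed.
Next Obligation. by move=> P Q S T h g f; apply/point_hom_eq/compA. Qed.

End Points.

Section ChangeOfBase.
Variables (C : finlimCategory) (E B : C) (p : E ~> B).

Let pb (P : Pt B) := fc_pullback p (pt_epi P).

Lemma cob_sec_comm (P : Pt B) : p \c idm E = pt_epi P \c (pt_sec P \c p).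
Proof. by rewrite compA pt_secK comp1m compm1. Qed.

Definition cob_obj (P : Pt B) : Pt E :=
  @Point C E (pb P) (pb_fst (pb P)) (pb_lift (pb P) (cob_sec_comm P))
    (pb_lift_fst _ _).

Lemma cob_mor_comm (P Q : Pt B) (f : P ~> Q) :
  p \c pb_fst (pb P) = pt_epi Q \c (pt_mor f \c pb_snd (pb P)).
Proof. by rewrite compA pt_mor_epi pb_comm. Qed.

Program Definition cob_mor (P Q : Pt B) (f : P ~> Q) :
    cob_obj P ~> cob_obj Q :=
  @PointHom C E (cob_obj P) (cob_obj Q)
    (pb_lift (pb Q) (cob_mor_comm f)) _ _.
Next Obligation. by move=> P Q f; apply: pb_lift_fst. Qed.
Next Obligation.
move=> P Q f; apply: pb_uniq; rewrite compA.
  by rewrite !pb_lift_fst.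
by rewrite !pb_lift_snd -compA pb_lift_snd compA pt_mor_sec.
Qed.

Program Definition change_of_base : functor (Pt B) (Pt E) :=
  @Functor (Pt B) (Pt E) cob_obj cob_mor _ _.
Next Obligation.
move=> P; apply/point_hom_eq/pb_uniq => /=.
  by rewrite pb_lift_fst compm1.
by rewrite pb_lift_snd comp1m compm1.
Qed.
Next Obligation.
move=> P Q S g f; apply/point_hom_eq/pb_uniq => /=; rewrite compA.
  by rewrite !pb_lift_fst.
by rewrite !pb_lift_snd -!compA pb_lift_snd.
Qed.

End ChangeOfBase.

Definition locally_algebraically_cartesian_closed (C : finlimCategory) : Prop :=
  forall (E B : C) (p : E ~> B), has_right_adjoint (change_of_base p).

(* The order is the one of the meet-semilattice: x <= y iff x /\ y = x. *)
Record heytingSemilattice := HeytingSemilattice {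
  hs_car :> Type;
  hs_top : hs_car;
  hs_meet : hs_car -> hs_car -> hs_car;
  hs_imp : hs_car -> hs_car -> hs_car;
  hs_meetA : associative hs_meet;
  hs_meetC : commutative hs_meet;
  hs_meetxx : idempotent_op hs_meet;
  hs_meetx1 : right_id hs_top hs_meet;
  hs_impP : forall x y z,
    hs_meet (hs_meet x y) z = hs_meet x y <-> hs_meet x (hs_imp y z) = x
}.
Arguments hs_top {h}.
Arguments hs_meet {h} x y.
Arguments hs_imp {h} x y.

Definition equationally_linear (H : heytingSemilattice) : Prop :=
  forall x y z : H,
    hs_meet (hs_imp (hs_imp x y) z) (hs_imp (hs_imp y x) z) = z.

Record elhslat := ELHS {
  elhs_hs :> heytingSemilattice;
  elhs_linear : equationally_linear elhs_hs
}.

Record hs_hom (H K : heytingSemilattice) := HSHom {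
  hs_fun :> H -> K;
  hs_fun1 : hs_fun hs_top = hs_top;
  hs_funI : {morph hs_fun : x y / hs_meet x y};
  hs_funi : {morph hs_fun : x y / hs_imp x y}
}.

Lemma hs_hom_eq (H K : heytingSemilattice) (f g : hs_hom H K) :
  f =1 g -> f = g.
Proof.
case: f g => [f f1 f2 f3] [g g1 g2 g3] /= /funext e.
case: _ / e g1 g2 g3 => g1 g2 g3.
by congr HSHom; apply: Prop_irrelevance.
Qed.

Definition hs_id (H : heytingSemilattice) : hs_hom H H :=
  @HSHom H H id erefl (fun _ _ => erefl) (fun _ _ => erefl).

Program Definition hs_comp (H K L : heytingSemilattice)
    (g : hs_hom K L) (f : hs_hom H K) : hs_hom H L :=
  @HSHom H L (fun x => g (f x)) _ _ _.
Next Obligation. by move=> H K L g f; rewrite /= !hs_fun1. Qed.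
Next Obligation. by move=> H K L g f x y /=; rewrite !hs_funI. Qed.
Next Obligation. by move=> H K L g f x y /=; rewrite !hs_funi. Qed.

Program Definition ELHSLat_cat : category :=
  @Category elhslat (fun H K => hs_hom H K)
    (fun H => hs_id H) (fun H K L => @hs_comp H K L) _ _ _.
Next Obligation. by move=> H K f; apply: hs_hom_eq. Qed.
Next Obligation. by move=> H K f; apply: hs_hom_eq. Qed.
Next Obligation. by move=> H K L M h g f; apply: hs_hom_eq. Qed.

Program Definition unit_hs : heytingSemilattice :=
  @HeytingSemilattice unit tt (fun _ _ => tt) (fun _ _ => tt) _ _ _ _ _.
Next Obligation. by []. Qed.
Next Obligation. by []. Qed.
Next Obligation. by case. Qed.
Next Obligation. by case. Qed.
Next Obligation. by case. Qed.

Program Definition unit_elhs : ELHSLat_cat := @ELHS unit_hs _.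
Next Obligation. by move=> x y []. Qed.

Program Definition ELHSLat_terminal : terminal ELHSLat_cat :=
  @Terminal ELHSLat_cat unit_elhs
    (fun H => @HSHom H unit_hs (fun _ => tt) _ _ _) _.
Next Obligation. by []. Qed.
Next Obligation. by []. Qed.
Next Obligation. by []. Qed.
Next Obligation. by move=> H f; apply: hs_hom_eq => x /=; case: (f x). Qed.

Section ELHSPullback.
Variables (X Y B : ELHSLat_cat) (p : X ~> B) (q : Y ~> B).

Definition fibprod : Type :=
  {u : elhs_hs X * elhs_hs Y | hs_fun p u.1 = hs_fun q u.2}.

Lemma fibprod_eq (u v : fibprod) :
  (sval u).1 = (sval v).1 -> (sval u).2 = (sval v).2 -> u = v.
Proof.
by case: u v => [[x y] e] [[x' y'] e'] /= ??; subst; congr exist;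
  apply: Prop_irrelevance.
Qed.

Program Definition fib_top : fibprod := exist _ (hs_top, hs_top) _.
Next Obligation. by rewrite /= !hs_fun1. Qed.

Program Definition fib_meet (u v : fibprod) : fibprod :=
  exist _ (hs_meet (sval u).1 (sval v).1, hs_meet (sval u).2 (sval v).2) _.
Next Obligation.
by move=> u v; rewrite /= !hs_funI (proj2_sig u) (proj2_sig v).
Qed.

Program Definition fib_imp (u v : fibprod) : fibprod :=
  exist _ (hs_imp (sval u).1 (sval v).1, hs_imp (sval u).2 (sval v).2) _.
Next Obligation.
by move=> u v; rewrite /= !hs_funi (proj2_sig u) (proj2_sig v).
Qed.

Program Definition fib_hs : heytingSemilattice :=
  @HeytingSemilattice fibprod fib_top fib_meet fib_imp _ _ _ _ _.
Next Obligation. by move=> u v w; apply: fibprod_eq; apply: hs_meetA. Qed.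
Next Obligation. by move=> u v; apply: fibprod_eq; apply: hs_meetC. Qed.
Next Obligation. by move=> u; apply: fibprod_eq; apply: hs_meetxx. Qed.
Next Obligation. by move=> u; apply: fibprod_eq; apply: hs_meetx1. Qed.
Next Obligation.
move=> u v w; split=> e; apply: fibprod_eq; apply/hs_impP;
  by [exact: (congr1 (fun t : fibprod => (sval t).1) e)
     |exact: (congr1 (fun t : fibprod => (sval t).2) e)].
Qed.

Program Definition fib_elhs : ELHSLat_cat := @ELHS fib_hs _.
Next Obligation. by move=> u v w; apply: fibprod_eq; apply: elhs_linear. Qed.

Definition fib_fst : fib_elhs ~> X :=
  @HSHom fib_hs X (fun u => (sval u).1) erefl
    (fun _ _ => erefl) (fun _ _ => erefl).

Definition fib_snd : fib_elhs ~> Y :=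
  @HSHom fib_hs Y (fun u => (sval u).2) erefl
    (fun _ _ => erefl) (fun _ _ => erefl).

Section Lift.
Variables (Z : ELHSLat_cat) (f : Z ~> X) (g : Z ~> Y).
Hypothesis e : p \c f = q \c g.

Definition fib_lift_fun (z : elhs_hs Z) : fibprod :=
  exist _ (hs_fun f z, hs_fun g z) (congr1 (fun h => hs_fun h z) e).

Program Definition fib_lift : Z ~> fib_elhs :=
  @HSHom Z fib_hs fib_lift_fun _ _ _.
Next Obligation. by apply: fibprod_eq; apply: hs_fun1. Qed.
Next Obligation. by move=> x y; apply: fibprod_eq; apply: hs_funI. Qed.
Next Obligation. by move=> x y; apply: fibprod_eq; apply: hs_funi. Qed.

End Lift.

Program Definition ELHSLat_pullback : pullback p q :=
  @Pullback ELHSLat_cat X Y B p q fib_elhs fib_fst fib_snd _ fib_lift _ _ _.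
Next Obligation. by apply: hs_hom_eq => u; apply: (proj2_sig u). Qed.
Next Obligation. by move=> Z f g e; apply: hs_hom_eq. Qed.
Next Obligation. by move=> Z f g e; apply: hs_hom_eq. Qed.
Next Obligation.
move=> Z h k e1 e2; apply: hs_hom_eq => z; apply: fibprod_eq.
  exact: (congr1 (fun m : hs_hom Z X => m z) e1).
exact: (congr1 (fun m : hs_hom Z Y => m z) e2).
Qed.

End ELHSPullback.

Definition ELHSLat : finlimCategory :=
  @FinlimCategory ELHSLat_cat ELHSLat_terminal ELHSLat_pullback.

(* Main.v *)
From mathcomp Require Import all_boot all_order.
Require Import Defs.

Set Implicit Arguments.
Unset Strict Implicit.
Unset Printing Implicit Defensive.

(** Write 2 for the two-element chain {0 < 1} and Z for the one-element algebra,
    which is a zero object. Local algebraic cartesian closedness already fails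
    for the morphism Z -> 2, along which change of base sends a point to the
    kernel of its split epimorphism.

    The point P = (2 x 2, snd, diagonal) has kernel {k, 1} with k = (0, 1).
    Relative to b = (0, 0), the image of 0 under the section, the element k
    satisfies an instance of Peirce's law: ((k -> b) -> k) = k. In any Heyting
    semilattice that instance forces ((k -> x) -> k) = k for every x above b
    ([peirce_above]). A morphism of points P -> Q carries k to an element of
    the kernel of Q that satisfies Peirce's law against the image of 0 under the
    section of Q, and that lies above this image. The latter does not depend on
    the morphism, so the images of k under two morphisms P -> Q satisfy Peirce's
    law against each other ([point_images_peirce]).

    In the kernel alone, k is unconstrained: for every y in an algebra Y, some
    morphism {k, 1} -> Y sends k to y ([kernel_hom]). If the kernel functor had
    a right adjoint, this morphism would factor as the kernel of a morphism of
    points out of P followed by the counit at Y ([counit_factor]), where the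
    codomain of the morphism of points depends only on Y. Hence any two elements
    of Y would satisfy Peirce's law against each other ([adjoint_peirce]). In
    the chain {0 < m < 1} this is false, since there ((m -> 0) -> m) = 1. *)

(** * Order in Heyting semilattices *)

Section HeytingOrder.
Variable H : heytingSemilattice.
Implicit Types x y z : H.

Definition hs_le x y := hs_meet x y = x.

Lemma hs_le_refl x : hs_le x x.
Proof. exact: hs_meetxx. Qed.

Lemma hs_le_trans y x z : hs_le x y -> hs_le y z -> hs_le x z.
Proof. by rewrite /hs_le => xy yz; rewrite -xy -hs_meetA yz. Qed.

Lemma hs_le_antisym x y : hs_le x y -> hs_le y x -> x = y.
Proof. by rewrite /hs_le => xy yx; rewrite -xy hs_meetC. Qed.

Lemma hs_leIl x y : hs_le (hs_meet x y) x.
Proof. by rewrite /hs_le hs_meetC hs_meetA hs_meetxx. Qed.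

Lemma hs_leIr x y : hs_le (hs_meet x y) y.
Proof. by rewrite hs_meetC; apply: hs_leIl. Qed.

Lemma hs_leIS x y z : hs_le x y -> hs_le (hs_meet z x) (hs_meet z y).
Proof.
rewrite /hs_le => xy.
by rewrite -hs_meetA [hs_meet x _]hs_meetC -hs_meetA [hs_meet y x]hs_meetC xy
           hs_meetA hs_meetxx.
Qed.

Lemma hs_le_impE x y z : hs_le x (hs_imp y z) <-> hs_le (hs_meet x y) z.
Proof. by split=> /hs_impP. Qed.

Lemma hs_modus_ponens x y : hs_le (hs_meet (hs_imp x y) x) y.
Proof. exact/hs_le_impE/hs_le_refl. Qed.

Lemma hs_le_imp x y : hs_le x (hs_imp y x).
Proof. exact/hs_le_impE/hs_leIl. Qed.

Lemma hs_top_imp x : hs_imp hs_top x = x.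
Proof.
apply: hs_le_antisym; last exact: hs_le_imp.
by have := hs_modus_ponens hs_top x; rewrite hs_meetx1.
Qed.

Lemma hs_imp_top x : hs_imp x hs_top = hs_top.
Proof.
apply: hs_le_antisym; first exact: hs_meetx1.
by apply/hs_le_impE; apply: hs_meetx1.
Qed.

Lemma hs_impxx x : hs_imp x x = hs_top.
Proof.
apply: hs_le_antisym; first exact: hs_meetx1.
by apply/hs_le_impE; apply: hs_leIr.
Qed.

Lemma hs_imp_monor x y z : hs_le y z -> hs_le (hs_imp x y) (hs_imp x z).
Proof.
by move=> yz; apply/hs_le_impE; apply: hs_le_trans yz; apply: hs_modus_ponens.
Qed.

Lemma hs_imp_antil x y z : hs_le x y -> hs_le (hs_imp y z) (hs_imp x z).
Proof.
move=> xy; apply/hs_le_impE; apply: hs_le_trans (hs_modus_ponens y z).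
exact: hs_leIS.
Qed.

(** The left-hand side of Peirce's law is antitone in x and always lies above
    k, so an equality at b propagates upwards. *)
Lemma peirce_above b x k :
  hs_le b x -> hs_imp (hs_imp k b) k = k -> hs_imp (hs_imp k x) k = k.
Proof.
move=> bx kb; apply: hs_le_antisym; last exact: hs_le_imp.
by rewrite -[X in hs_le _ X]kb; apply/hs_imp_antil/hs_imp_monor.
Qed.

End HeytingOrder.

Lemma hs_hom_le (H K : heytingSemilattice) (f : hs_hom H K) (x y : H) :
  hs_le x y -> hs_le (f x) (f y).
Proof. by rewrite /hs_le -hs_funI => ->. Qed.

(** * Chains *)

Import Order.TTheory.
Local Open Scope order_scope.
Local Open Scope cat_scope.

Section Chain.
Context {d : Order.disp_t} (T : orderType d) (top : T).
Hypothesis le_top : forall x : T, x <= top.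
Implicit Types x y z : T.

Definition chain_imp x y := if x <= y then top else y.

Lemma chain_impP x y z :
  x `&` y `&` z = x `&` y <-> x `&` chain_imp y z = x.
Proof.
have -> : x `&` y `&` z = x `&` y <-> x `&` y <= z.
  by split=> [/meet_idPl|/meet_idPl].
have -> : x `&` chain_imp y z = x <-> x <= chain_imp y z.
  by split=> [/meet_idPl|/meet_idPl].
rewrite /chain_imp leIx; case: (leP y z) => [yz|_].
  by rewrite le_top orbT.
by rewrite orbF.
Qed.

Lemma chain_meetx1 x : x `&` top = x.
Proof. exact/meet_idPl. Qed.

Definition chain_hs : heytingSemilattice :=
  @HeytingSemilattice T top Order.meet chain_imp
    (@meetA _ T) (@meetC _ T) (@meetxx _ T) chain_meetx1 chain_impP.

(** Of x -> y and y -> x one is the top element, hence one of the two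
    conjuncts is z while the other lies above z. *)
Lemma chain_linear : equationally_linear chain_hs.
Proof.
have imp1 z : chain_imp top z = z.
  by rewrite /chain_imp; case: leP => // ?; apply/le_anti; rewrite le_top andbT.
have le_imp y z : z <= chain_imp y z.
  by rewrite /chain_imp; case: ifP => _; rewrite ?le_top.
move=> x y z /=; case: (leP x y) => [xy|/ltW yx].
  by rewrite {2}/chain_imp xy imp1; apply/meet_idPl.
by rewrite {4}/chain_imp yx imp1; apply/meet_idPr.
Qed.

Definition chain_elhs : ELHSLat := ELHS chain_linear.

End Chain.

(** * Consequences of an adjunction *)

(** The factorization through the counit, with the counit obtained as the
    arrow whose transpose is the identity. *)
Lemma counit_factor (C D : category) (F : functor C D) (G : functor D C) :
  adjunction F G -> forall y : D,
  exists e : F (G y) ~> y,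
    forall (x : C) (h : F x ~> y), exists g : x ~> G y, h = e \c fmap F g.
Proof.
move=> adj y; have [t tK Kt] := transpose_bij adj (G y) y.
exists (t (idm (G y))) => x h; exists (transpose adj h).
apply: (bij_inj (transpose_bij adj x y)).
by rewrite transpose_natl Kt comp1m.
Qed.

(** * The kernel functor of the two-element chain *)

Definition zero_hom (X : ELHSLat) : @hom ELHSLat unit_elhs X :=
  @HSHom unit_hs X (fun _ => hs_top) erefl
    (fun _ _ => esym (hs_meetxx _)) (fun _ _ => esym (hs_impxx _)).

Lemma to_zero_uniq (X : ELHSLat) (f g : @hom ELHSLat X unit_elhs) : f = g.
Proof.
by rewrite [f](term_uniq (t := fc_terminal ELHSLat))
           [g](term_uniq (t := fc_terminal ELHSLat)).
Qed.

(** Morphisms preserve the top element, which makes the terminal object also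
    initial. *)
Lemma from_zero_uniq (X : ELHSLat) (f g : @hom ELHSLat unit_elhs X) : f = g.
Proof. by apply: hs_hom_eq; case; rewrite (hs_fun1 f) (hs_fun1 g). Qed.

Definition two : ELHSLat := @chain_elhs _ bool true leq_b1.

Definition kernel : functor (Pt two) (@Pt ELHSLat unit_elhs) :=
  @change_of_base ELHSLat _ _ (zero_hom two).

Definition two_sq : ELHSLat :=
  @fc_pullback ELHSLat _ _ _ (term_arr (fc_terminal ELHSLat) two)
              (term_arr (fc_terminal ELHSLat) two).

Definition diag_point : Pt two :=
  @Point ELHSLat two two_sq (pb_snd _)
    (pb_lift _ (f := idm two) (g := idm two) erefl) (pb_lift_snd _ _).

Definition two_pair (x y : bool) : elhs_hs two_sq := exist _ (x, y) erefl.

Definition diag_bot := two_pair false false.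
Definition diag_gen := two_pair false true.

Definition zero_point (Y : ELHSLat) : @Pt ELHSLat unit_elhs :=
  @Point ELHSLat unit_elhs Y (term_arr (fc_terminal ELHSLat) Y) (zero_hom Y)
    (to_zero_uniq _ _).

(** Here diag_gen -> diag_bot is the complement (1, 0) of diag_gen = (0, 1).
    In 2 x 2, as in any Boolean algebra, an element is equal to the implication
    from its complement to it. *)
Lemma diag_gen_peirce :
  hs_imp (hs_imp diag_gen diag_bot) diag_gen = diag_gen.
Proof. by apply: fibprod_eq. Qed.

(** The base element of Q, the value of its section at the bottom of the chain,
    is the image of diag_bot under every morphism of points. It therefore lies
    below the first image of diag_gen and can be replaced by it in Peirce's law
    for the second. *)
Lemma point_images_peirce (Q : Pt two) (f g : diag_point ~> Q) :
  let k1 := hs_fun (pt_mor f) diag_gen in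
  let k2 := hs_fun (pt_mor g) diag_gen in
  hs_imp (hs_imp k2 k1) k2 = k2.
Proof.
have bE (h : diag_point ~> Q) :
    hs_fun (pt_mor h) diag_bot = hs_fun (pt_sec Q) false.
  by rewrite -(pt_mor_sec h) /=; congr (hs_fun _ _); apply: fibprod_eq.
move=> k1 k2; apply: (@peirce_above _ (hs_fun (pt_sec Q) false)).
  by rewrite -(bE f); apply: hs_hom_le; apply: fibprod_eq.
by rewrite -(bE g) /k2 -!hs_funi diag_gen_peirce.
Qed.

Definition kernel_gen : elhs_hs (pt_obj (kernel diag_point)) :=
  exist _ (tt, diag_gen) erefl.

Section KernelHom.
Variables (Y : ELHSLat) (y : elhs_hs Y).

(** An element of the kernel has the form (tt, (c, true)), so that its component
    c determines it. *)
Definition kernel_fun (u : elhs_hs (pt_obj (kernel diag_point))) : elhs_hs Y :=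
  if (sval (sval u).2).1 then hs_top else y.

Lemma kernel_funI : {morph kernel_fun : u v / hs_meet u v}.
Proof.
move=> [[? [[[] ?] ?]] ?] [[? [[[] ?] ?]] ?]; rewrite /kernel_fun /=.
all: by rewrite ?hs_meetxx ?hs_meetx1 // hs_meetC hs_meetx1.
Qed.

Lemma kernel_funi : {morph kernel_fun : u v / hs_imp u v}.
Proof.
move=> [[? [[[] ?] ?]] ?] [[? [[[] ?] ?]] ?]; rewrite /kernel_fun /=.
all: by rewrite ?hs_impxx ?hs_top_imp ?hs_imp_top.
Qed.

Definition kernel_hom : kernel diag_point ~> zero_point Y :=
  @PointHom ELHSLat unit_elhs (kernel diag_point) (zero_point Y)
    (@HSHom _ _ kernel_fun erefl kernel_funI kernel_funi)
    (to_zero_uniq _ _)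
    (from_zero_uniq _ _).

End KernelHom.

(** Both elements come, through the counit, from images of the generator under
    parallel morphisms of points. Peirce's law holds for these images in the
    second factor of the pullback that computes the kernel, hence in the kernel,
    and the counit transports it to Y. *)
Lemma adjoint_peirce (Y : ELHSLat) (x y : elhs_hs Y) :
  has_right_adjoint kernel -> hs_imp (hs_imp y x) y = y.
Proof.
case=> G [adj]; have [e eE] := counit_factor adj (zero_point Y).
have [f fE] := eE _ (kernel_hom x); have [g gE] := eE _ (kernel_hom y).
have genE z (h : diag_point ~> G (zero_point Y)) :
    kernel_hom z = e \c fmap kernel h ->
    z = hs_fun (pt_mor e) (hs_fun (pt_mor (fmap kernel h)) kernel_gen).
  by move=> hE; rewrite -[LHS]/(hs_fun (pt_mor (kernel_hom z)) kernel_gen) hE.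
rewrite (genE _ _ fE) (genE _ _ gE) -!hs_funi; congr (hs_fun _ _).
apply: fibprod_eq => /=; first by case: (X in _ = X).
exact: point_images_peirce.
Qed.

Definition three : ELHSLat := @chain_elhs _ 'I_3 ord_max (@leq_ord 2).

Theorem theorem5p4 : ~ locally_algebraically_cartesian_closed ELHSLat.
Proof.
move=> lacc; pose one : 'I_3 := Ordinal (isT : (1 < 3)%N).
by have /(congr1 val) := @adjoint_peirce three ord0 one (lacc _ _ _).
Qed.
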